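(* There is a function $\varepsilon:\mathbb{N}\to[0,\infty)$ with $\varepsilon(n)\to 0$ as $n\to\infty$ such that the following holds for every $n$. Let $D$ be a loopless multigraph (not necessarily bipartite) on the vertex set $A\cup B$ of $K_{n,n}$. If \[ \Delta(D)\le (1-\varepsilon(n))\cdot\frac{n}{4}, \] then $D$ is realizable in $K_{n,n}$.
   Context: $K_{n,n}$ is the complete bipartite graph with color classes $A=\{a_1,\dots,a_n\}$ and $B=\{b_1,\dots,b_n\}$. Given a simple graph $G$ (the base graph) and a loopless multigraph $D$ (the demand graph) on the same vertex set, $D$ is realizable in $G$ if one can choose, for every edge $e\in E(D)$ (counted with multiplicity), a path $P(e)$ in $G$ joining the end-vertices of $e$, such that these paths are pairwise edge-disjoint. $\Delta(D)$ denotes the maximum degree of $D$ (counting multiplicities). *)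

(* Defs.v *)
From HB Require Import structures.
From mathcomp Require Import all_boot.

Set Implicit Arguments.
Unset Strict Implicit.
Unset Printing Implicit Defensive.

Record sgraph (V : finType) := SGraph {
  sg_adj : rel V;
  sg_sym : symmetric sg_adj;
  sg_irrefl : irreflexive sg_adj
}.

(* Edges are elements of a finite type, so parallel edges are distinct edges
   with the same set of end-vertices. *)
Record multigraph (V : finType) := Multigraph {
  mg_edge : finType;
  mg_ends : mg_edge -> {set V};
  mg_loopless : forall e, #|mg_ends e| = 2
}.

Definition mg_degree (V : finType) (D : multigraph V) (v : V) : nat :=
  #|[set e : mg_edge D | v \in mg_ends e]|.

Definition max_degree (V : finType) (D : multigraph V) : nat :=
  \max_(v : V) mg_degree D v.

(* A path is given by its nonempty sequence of pairwise distinct vertices. *)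
Definition is_gpath (V : finType) (G : sgraph V) (s : seq V) : bool :=
  if s is x :: p then path (sg_adj G) x p && uniq s else false.

Definition gpath_ends (V : finType) (s : seq V) : {set V} :=
  if s is x :: p then [set x; last x p] else set0.

Definition gpath_edges (V : finType) (s : seq V) : {set {set V}} :=
  if s is x :: p then [set e in pairmap (fun u v => [set u; v]) x p] else set0.

Definition realizable (V : finType) (G : sgraph V) (D : multigraph V) : Prop :=
  exists P : mg_edge D -> seq V,
    [/\ forall e, is_gpath G (P e),
        forall e, gpath_ends (P e) = mg_ends e
      & forall e f, e != f -> [disjoint gpath_edges (P e) & gpath_edges (P f)]].

(* The color class A is the left copy of 'I_n and B is the right copy. *)
Definition Knn_adj (n : nat) : rel ('I_n + 'I_n)%type := fun x y =>
  match x, y with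
  | inl _, inr _ | inr _, inl _ => true
  | _, _ => false
  end.

Lemma Knn_adj_sym n : symmetric (@Knn_adj n).
Proof. by case=> ? []. Qed.

Lemma Knn_adj_irrefl n : irreflexive (@Knn_adj n).
Proof. by case. Qed.

Definition Knn (n : nat) : sgraph ('I_n + 'I_n)%type :=
  SGraph (@Knn_adj_sym n) (@Knn_adj_irrefl n).

(* Main.v *)
Require Import Defs.
From mathcomp Require Import all_boot.
From mathcomp Require Import zify.

Set Implicit Arguments.
Unset Strict Implicit.
Unset Printing Implicit Defensive.

(** Let [d] bound the degrees of [D] and let [4 d + 18 <= n]. Every demand is
    routed through a hub, a vertex of [B]. Split [B] into its even and odd
    halves.

    First, the demands that meet [A] are coloured by vertices of [B], the colour
    being the hub, so that demands with a common end in [A] get distinct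
    colours and a demand [ab] gets a colour in the half not containing [b].
    A greedy colouring exists; Kempe changes inside a half and recolourings of
    demands inside [A] then make every colour cover at most [d + 6] vertices of
    [A]. A demand inside one half of [B] receives a hub in the other half, with
    balanced loads, and the hub of a demand between the halves is its even end.

    It remains to join each end [x] in [B] of a demand to its hub by a path of
    length two through some vertex of [A]. These pairs form a bipartite
    multigraph between the two halves, of maximum degree at most [2 d + 6], and
    each pair has at least [n - 2 (d + 6)] vertices of [A] that do not interfere
    with the first step. Galvin's theorem on list edge colourings of bipartite
    multigraphs finishes the proof. *)

(** * Kempe changes *)

Section Dihedral.
Variables (T : finType) (f g : T -> T).
Hypotheses (fK : involutive f) (gK : involutive g).
Let h x := g (f x).

Lemma dihedral_inj : injective h.
Proof. by move=> x y; rewrite /h => /(inv_inj gK) /(inv_inj fK). Qed.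
Let h_inj := dihedral_inj.

Variables (v : T) (gv : g v = v).
Let N := order h v.

Lemma dihedral_orbitP w :
  reflect (exists2 i, i < N & w = iter i h v) (fconnect h v w).
Proof.
apply: (iffP idP) => [vw|[i _ ->]]; last exact: fconnect_iter.
by exists (findex h v w); rewrite ?findex_max ?iter_findex.
Qed.

Lemma dihedral_iter_inj i j :
  i < N -> j < N -> iter i h v = iter j h v -> i = j.
Proof.
by move=> iN jN ij; rewrite -(findex_iter (f := h) iN) -/h ij findex_iter.
Qed.

(* On the [h]-orbit of [v], identified with Z/N, [f] is i |-> -1 - i and [g] is
   i |-> -i; so besides [v] at most one point is fixed by [f] or by [g]. *)
Lemma dihedral_f_iter i : i < N -> f (iter i h v) = iter (N - i.+1) h v.
Proof.
move=> iN.
(* Since [h f h = f], one factor [h] cancels on each side of [f]. *)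
have Hi j : iter j.+1 h (f (iter j h v)) = v.
  elim: j => [|j IH]; first by rewrite /= /h fK gv.
  by rewrite iterSr -[RHS]IH; congr (iter _ _ _); rewrite /h /= fK gK.
have inj_it k : injective (iter k h).
  by elim: k => //= k IH x y /h_inj /IH.
apply: (inj_it i.+1); rewrite Hi -iterD subnKC //.
by rewrite /N (iter_order h_inj).
Qed.

Lemma dihedral_g_iter i : 0 < i < N -> g (iter i h v) = iter (N - i) h v.
Proof.
case: i => // i /andP [_ iN]; rewrite [in LHS]/= {1}/h gK dihedral_f_iter //.
by apply: ltnW.
Qed.

Lemma dihedral_f_closed w : fconnect h v w -> fconnect h v (f w).
Proof.
by case/dihedral_orbitP=> i iN ->; rewrite dihedral_f_iter // fconnect_iter.
Qed.

Lemma dihedral_g_closed w : fconnect h v w -> fconnect h v (g w).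
Proof.
case/dihedral_orbitP=> [[|i]] iN ->; first by rewrite /= gv connect0.
by rewrite dihedral_g_iter // fconnect_iter.
Qed.

(** A point of index [i] fixed by [f] gives [2 i + 1 = N], and one with [i > 0] fixed by [g] gives
    [2 i = N]. Either way [i] is [N./2]; the parity of [N] decides which involution fixes the far
    end. *)
Lemma dihedral_fixed w : fconnect h v w -> (f w == w) || (g w == w) ->
  w = v \/ w = iter N./2 h v.
Proof.
case/dihedral_orbitP=> i iN -> /orP [] /eqP.
  rewrite dihedral_f_iter // => /dihedral_iter_inj E; right; congr (iter _ h v).
  by have := E ltac:(lia) iN; lia.
case: i iN => [|i] iN; first by left.
rewrite dihedral_g_iter // => /dihedral_iter_inj E; right; congr (iter _ h v).
by have := E ltac:(lia) iN; lia.
Qed.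

End Dihedral.

Lemma exists_notin (C : eqType) (s t : seq C) :
  uniq s -> size t < size s -> exists2 c, c \in s & c \notin t.
Proof.
move=> us st; apply/hasP; apply: contraLR st => /hasPn sub_st.
rewrite -leqNgt uniq_leq_size // => c /sub_st.
by rewrite negbK.
Qed.

(** * Colourings of set systems and their alternating chains *)

Section SetSystemColoring.
Variables (T E : finType) (C : eqType) (S : E -> {set T}).

Definition proper_col (col : E -> C) :=
  forall e f, e != f -> col e = col f -> [disjoint S e & S f].

Definition cover_by (col : E -> C) (c : C) : {set T} :=
  \bigcup_(e | col e == c) S e.

Lemma cover_byP col c v :
  reflect (exists2 e, col e = c & v \in S e) (v \in cover_by col c).
Proof.
apply: (iffP bigcupP) => [[e /eqP]|[e /eqP]]; by exists e.
Qed.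

Lemma proper_col_uniq col e f v : proper_col col ->
  col e = col f -> v \in S e -> v \in S f -> e = f.
Proof.
move=> pr ef ve vf; apply: contraTeq ve => /pr /(_ ef).
by rewrite disjoint_sym => /disjointFr ->.
Qed.

Lemma card_cover_by col c : proper_col col ->
  #|cover_by col c| = \sum_(e | col e == c) #|S e|.
Proof.
move=> pr; pose F e := if col e == c then S e else set0.
have -> : cover_by col c = \bigcup_e F e by rewrite /cover_by big_mkcond.
have dF e f : e != f -> [disjoint F e & F f].
  move=> ef; rewrite /F; case: eqP => [Ee|_]; last by rewrite disjoints_subset sub0set.
  case: eqP => [Ef|_]; last by rewrite disjoint_sym disjoints_subset sub0set.
  by apply: pr; rewrite ?Ee.
rewrite -sum1_card (partition_disjoint_bigcup _ _ dF) [RHS]big_mkcond.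
apply: eq_bigr => e _; rewrite sum1_card /F.
by case: ifP; rewrite ?cards0.
Qed.

Section Kempe.
Variable col : E -> C.
Hypotheses (S2 : forall e, #|S e| <= 2) (pr : proper_col col).

(** The value is [v] itself if no set of colour [c] contains [v], and also if the one that does is a
    singleton. Under a proper colouring by sets of size at most two this is a total involution, so
    alternating chains become orbits. *)
Definition mate c v : T :=
  if [pick e | (col e == c) && (v \in S e)] is Some e
  then odflt v [pick w in S e :\ v] else v.

Lemma mateE e v : v \in S e -> mate (col e) v = odflt v [pick w in S e :\ v].
Proof.
move=> ve; rewrite /mate; case: pickP => [f /andP [/eqP fe vf]|/(_ e)].
  by rewrite (proper_col_uniq pr fe vf ve).
by rewrite eqxx ve.
Qed.

Lemma mate_in e v : v \in S e -> mate (col e) v \in S e.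
Proof. by move=> ve; rewrite mateE //; case: pickP => //= w /setD1P []. Qed.

Lemma mate_out c v : v \notin cover_by col c -> mate c v = v.
Proof.
move=> vc; rewrite /mate; case: pickP => // e /andP [/eqP ec ve].
by case/cover_byP: vc; exists e.
Qed.

Lemma eq_mate e v w : v \in S e -> w \in S e -> w != v -> mate (col e) v = w.
Proof.
move=> ve we wv; rewrite mateE //; case: pickP => [u /setD1P [uv ue]|/(_ w)] /=.
  apply/eqP; apply: contraT => uw; have := S2 e.
  rewrite (cardsD1 v) ve (cardsD1 u) (cardsD1 w) !inE uv ue wv we (eq_sym w u) uw.
  by [].
by rewrite !inE wv we.
Qed.

Lemma mateK c : involutive (mate c).
Proof.
move=> v; have [/cover_byP [e <- ve]|vc] := boolP (v \in cover_by col c); last by rewrite !mate_out.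
have [mv|mv] := eqVneq (mate (col e) v) v; first by rewrite !mv.
by apply: eq_mate; rewrite ?mate_in // eq_sym.
Qed.

(** Only the product of the two mates is iterated. This gives the whole chain through [v] when [v]
    misses [c']; on an alternating cycle it can give just half of the vertices. *)
Definition kempe c c' v : {set T} :=
  [set w | fconnect (fun x => mate c' (mate c x)) v w].

Lemma kempe_refl c c' v : v \in kempe c c' v.
Proof. by rewrite inE connect0. Qed.

Lemma kempe_eq c c' v w u :
  u \in kempe c c' v -> u \in kempe c c' w -> kempe c c' v = kempe c c' w.
Proof.
have sym := fconnect_sym (dihedral_inj (mateK c) (mateK c')).
rewrite !inE => vu wu; apply/setP => x; rewrite !inE.
by rewrite (same_connect sym vu) (same_connect sym wu).
Qed.

Definition kempe_closed c c' (O : {set T}) := forall e,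
  col e \in [:: c; c'] -> ~~ [disjoint S e & O] -> S e \subset O.

(** The mate for [c'] fixes [v], so the orbit is closed under both involutions, hence under passing
    to the other point of a set of either colour. *)
Lemma kempe_closedP c c' v : v \notin cover_by col c' ->
  kempe_closed c c' (kempe c c' v).
Proof.
move=> vc' e ec /pred0Pn [w /andP [/= we wO]]; apply/subsetP => u ue.
have [-> //|uw] := eqVneq u w; have := eq_mate we ue uw.
move: wO ec; rewrite !inE => wO /orP [] /eqP -> <-.
  exact: (dihedral_f_closed (mateK c) (mateK c') (mate_out vc')).
exact: (dihedral_g_closed (mateK c) (mateK c') (mate_out vc')).
Qed.

(** A point missed by a colour is fixed by the mate for that colour, and the chain has at most one
    fixed point besides [v]. *)
Lemma kempe_ends c c' v : v \notin cover_by col c' -> exists m,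
  m \in kempe c c' v /\ forall w, w \in kempe c c' v ->
  w \notin cover_by col c :&: cover_by col c' -> w = v \/ w = m.
Proof.
move=> vc'; exists (iter (order (fun x => mate c' (mate c x)) v)./2
  (fun x => mate c' (mate c x)) v); split=> [|w]; first by rewrite inE fconnect_iter.
rewrite inE => vw; rewrite inE negb_and => wc.
apply: (dihedral_fixed (mateK c) (mateK c') (mate_out vc') vw).
by case/orP: wc => /mate_out ->; rewrite eqxx ?orbT.
Qed.

Definition kempe_swap c c' (O : {set T}) e :=
  if [disjoint S e & O] then col e
  else if col e == c then c' else if col e == c' then c else col e.

Variables (c c' : C) (O : {set T}).
Hypotheses (cc' : c != c') (cO : kempe_closed c c' O).

Lemma kempe_swap_in e v : v \in S e -> v \in O -> kempe_swap c c' O e =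
  if col e == c then c' else if col e == c' then c else col e.
Proof.
move=> ve vO; rewrite /kempe_swap ifN //; apply/pred0Pn; exists v.
by rewrite /= ve.
Qed.

Lemma kempe_swap_out e v : v \in S e -> v \notin O -> kempe_swap c c' O e = col e.
Proof.
move=> ve vO; rewrite /kempe_swap; case: ifPn => // SO.
have sub : col e \in [:: c; c'] -> False.
  by move/cO/(_ SO)/subsetP/(_ v ve); apply/negP.
case: eqP => [E1|_]; first by case: sub; rewrite E1 !inE eqxx.
by case: eqP => // E1; case: sub; rewrite E1 !inE eqxx orbT.
Qed.

(** Around each point all colours undergo the same permutation: the transposition inside [O] and, by
    closedness, the identity outside. *)
Lemma kempe_swap_proper : proper_col (kempe_swap c c' O).
Proof.
move=> e f ef; apply: contraPT => /pred0Pn [v /andP [/= ve vf]].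
have Ncol : col e <> col f.
  by move=> E1; case/eqP: ef; apply: (proper_col_uniq pr E1 ve vf).
have /eqP ncc' := cc'.
have [vO|vO] := boolP (v \in O).
  rewrite !(kempe_swap_in _ vO) //.
  by do ![case: eqP => ?]; congruence.
by rewrite !(kempe_swap_out _ vO).
Qed.

Lemma kempe_swap_coverE k v : v \in cover_by (kempe_swap c c' O) k =
  (v \in cover_by col (if v \in O then if k == c then c' else if k == c' then c else k else k)).
Proof.
apply/cover_byP/cover_byP => [[e <- ve]|[e ek ve]]; exists e => //.
  case: ifPn => vO; last by rewrite (kempe_swap_out ve).
  rewrite (kempe_swap_in ve vO).
  have [->|n1] := eqVneq (col e) c; first by rewrite eq_sym (negbTE cc') eqxx.
  have [->|n2] := eqVneq (col e) c'; first by rewrite eqxx.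
  by rewrite (negbTE n1) (negbTE n2).
move: ek; case: ifPn => vO ek; last by rewrite (kempe_swap_out ve vO).
rewrite (kempe_swap_in ve vO) ek.
have [->|n1] := eqVneq k c; first by rewrite eq_sym (negbTE cc') eqxx.
have [->|n2] := eqVneq k c'; first by rewrite eqxx.
by rewrite (negbTE n1) (negbTE n2).
Qed.

End Kempe.
End SetSystemColoring.

(** * List edge colourings of bipartite multigraphs *)

Section Bipartite.
Variables (E X Y : finType) (l : E -> X) (r : E -> Y).

(** Edges outside [F] get the empty set, so a colouring of the whole type [E] is constrained only on
    [F], and only [F] contributes to covers. *)
Definition bip_ends (F : {set E}) e : {set X + Y} :=
  if e \in F then [set inl (l e); inr (r e)] else set0.

Lemma bip_ends_card F e : #|bip_ends F e| <= 2.
Proof. by rewrite /bip_ends; case: ifP; rewrite ?cards2 ?cards0. Qed.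

Lemma mem_bip_ends_l F e x : (inl x \in bip_ends F e) = (e \in F) && (l e == x).
Proof. by rewrite /bip_ends; case: ifP; rewrite !inE //= orbF eq_sym. Qed.

Lemma mem_bip_ends_r F e y : (inr y \in bip_ends F e) = (e \in F) && (r e == y).
Proof. by rewrite /bip_ends; case: ifP; rewrite !inE //= eq_sym. Qed.

Lemma bip_mate F (col : E -> nat) c w : proper_col (bip_ends F) col ->
  w \in cover_by (bip_ends F) col c ->
  is_inl (mate (bip_ends F) col c w) = ~~ is_inl w.
Proof.
move=> pr /cover_byP [e <-]; case: w => z wz.
  move: (wz); rewrite mem_bip_ends_l => /andP [eF _].
  rewrite (eq_mate (bip_ends_card F) pr wz (w := inr (r e))) //.
  by rewrite mem_bip_ends_r eF eqxx.
move: (wz); rewrite mem_bip_ends_r => /andP [eF _].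
rewrite (eq_mate (bip_ends_card F) pr wz (w := inl (l e))) //.
by rewrite mem_bip_ends_l eF eqxx.
Qed.

(* If the chain from [inr y] reached [inl x], each colour class would match the
   two sides of the chain up to one missing vertex, on opposite sides. *)
Lemma bip_kempe_avoid F (col : E -> nat) a b x y :
  proper_col (bip_ends F) col ->
  inl x \notin cover_by (bip_ends F) col a ->
  inl x \in cover_by (bip_ends F) col b ->
  inr y \notin cover_by (bip_ends F) col b ->
  inr y \in cover_by (bip_ends F) col a ->
  inl x \notin kempe (bip_ends F) col a b (inr y).
Proof.
set S := bip_ends F; move=> pr xa xb yb ya; apply/negP => xO.
set O := kempe S col a b (inr y) in xO.
have yO : inr y \in O by apply: kempe_refl.
have S2 := bip_ends_card F : forall e, #|S e| <= 2.
have cO : kempe_closed S col a b O by apply: kempe_closedP.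
have [m [_ Hm]] := kempe_ends S2 pr a yb.
rewrite -/O in Hm; clearbody O.
have mx : inl x = m by case: (Hm _ xO) => //; rewrite inE (negbTE xa).
subst m.
have mateO k w : k \in [:: a; b] -> w \in O -> w \in cover_by S col k ->
    mate S col k w \in O :&: cover_by S col k.
  move=> kab wO /cover_byP [e ek we]; rewrite inE -ek; apply/andP; split.
    have /subsetP : S e \subset O.
      by apply: cO; [rewrite ek | apply/pred0Pn; exists w; rewrite /= we].
    by apply; apply: mate_in.
  by apply/cover_byP; exists e; rewrite ?mate_in.
have both w : w \in O -> w != inl x -> w != inr y ->
    (w \in cover_by S col a) && (w \in cover_by S col b).
  move=> wO wx wy; apply: contraT => wab.
  have [|E1|E1] := Hm w wO; first by rewrite inE.
    by rewrite E1 eqxx in wy.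
  by rewrite E1 eqxx in wx.
pose OL := [set w in O | is_inl w]; pose OR := [set w in O | ~~ is_inl w].
have minj k : injective (mate S col k) by apply: inv_inj; apply: mateK.
have HR : #|OR| <= #|OL :\ inl x|.
  rewrite -(card_imset _ (minj a)); apply: subset_leq_card.
  apply/subsetP => _ /imsetP [w wO ->]; move: wO; rewrite inE => /andP [wO wR].
  have wa : w \in cover_by S col a.
    have [->|wy] := eqVneq w (inr y); first by [].
    have wx : w != inl x by apply: contraNneq wR => ->.
    by case/andP: (both w wO wx wy).
  have /setIP [mO ma] := mateO a w ltac:(by rewrite !inE eqxx) wO wa.
  rewrite !inE mO bip_mate // wR !andbT.
  by apply: contraNneq xa => <-.
have HL : #|OL| <= #|OR :\ inr y|.
  rewrite -(card_imset _ (minj b)); apply: subset_leq_card.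
  apply/subsetP => _ /imsetP [w wO ->]; move: wO; rewrite inE => /andP [wO wL].
  have wb : w \in cover_by S col b.
    have [->|wx] := eqVneq w (inl x); first by [].
    have wy : w != inr y by apply: contraTneq wL => ->.
    by case/andP: (both w wO wx wy).
  have /setIP [mO mb] := mateO b w ltac:(by rewrite !inE eqxx orbT) wO wb.
  rewrite !inE mO bip_mate // wL !andbT.
  by apply: contraNneq yb => <-.
move: HR HL; rewrite [#|OL|](cardsD1 (inl x)) [#|OR|](cardsD1 (inr y)).
have xL : inl x \in OL by rewrite inE xO.
have yR : inr y \in OR by rewrite inE yO.
by rewrite xL yR !add1n => H1 H2; have := leq_trans H1 (ltnW H2); rewrite ltnn.
Qed.

(** Remove an edge [e0] and colour the rest. Fewer than [k] remaining edges meet either end of [e0],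
    so some [a] is free at the left end and some [b] at the right end. If neither is free at both, a
    swap on the chain from the right end, which avoids the left end, frees [a] at both. *)
Lemma konig_edge_coloring k (F : {set E}) :
  (forall x, #|[set e in F | l e == x]| <= k) ->
  (forall y, #|[set e in F | r e == y]| <= k) ->
  exists2 col : E -> nat, proper_col (bip_ends F) col &
    forall e, e \in F -> col e < k.
Proof.
elim: {F}#|F| {-2}F (erefl #|F|) => [|m IH] F.
  move/eqP; rewrite cards_eq0 => /eqP -> _ _; exists (fun=> 0) => [e f _ _|e].
    by rewrite /bip_ends inE disjoints_subset sub0set.
  by rewrite inE.
move=> cF dl dr; have [F0|[e0 e0F]] := set_0Vmem F; first by rewrite F0 cards0 in cF.
pose F' := F :\ e0.
have cF' : #|F'| = m by move: cF; rewrite (cardsD1 e0) e0F => -[].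
have subl x : [set e in F' | l e == x] \subset [set e in F | l e == x].
  by apply/subsetP => e; rewrite !inE => /andP [/andP [_ ->] ->].
have subr y : [set e in F' | r e == y] \subset [set e in F | r e == y].
  by apply/subsetP => e; rewrite !inE => /andP [/andP [_ ->] ->].
have [||col pr colk] := IH F' cF'.
- by move=> x; apply: leq_trans (dl x); apply: subset_leq_card.
- by move=> y; apply: leq_trans (dr y); apply: subset_leq_card.
have [a ak xa] : exists2 a, a < k & inl (l e0) \notin cover_by (bip_ends F') col a.
  have [|a] := @exists_notin _ (iota 0 k)
    [seq col e | e in [set e in F' | l e == l e0]] (iota_uniq 0 k).
    rewrite size_map -cardE size_iota; apply: leq_trans (dl (l e0)).
    apply: proper_card; apply/properP; split=> //.
    by exists e0; rewrite !inE ?eqxx ?e0F.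
  rewrite mem_iota /= add0n => ak na; exists a => //.
  apply: contra na => /cover_byP [e <-]; rewrite mem_bip_ends_l => eF.
  by apply: image_f; rewrite inE.
have [b bk yb] : exists2 b, b < k & inr (r e0) \notin cover_by (bip_ends F') col b.
  have [|b] := @exists_notin _ (iota 0 k)
    [seq col e | e in [set e in F' | r e == r e0]] (iota_uniq 0 k).
    rewrite size_map -cardE size_iota; apply: leq_trans (dr (r e0)).
    apply: proper_card; apply/properP; split=> //.
    by exists e0; rewrite !inE ?eqxx ?e0F.
  rewrite mem_iota /= add0n => bk nb; exists b => //.
  apply: contra nb => /cover_byP [e <-]; rewrite mem_bip_ends_r => eF.
  by apply: image_f; rewrite inE.
have [col1 [c [pr1 colk1 ck xc yc]]] : exists col1 c,
    [/\ proper_col (bip_ends F') col1, forall e, e \in F' -> col1 e < k, c < k,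
        inl (l e0) \notin cover_by (bip_ends F') col1 c
      & inr (r e0) \notin cover_by (bip_ends F') col1 c].
  have [ya|ya] := boolP (inr (r e0) \in cover_by (bip_ends F') col a); last by exists col, a.
  have [xb|xb] := boolP (inl (l e0) \in cover_by (bip_ends F') col b); last by exists col, b.
  have xO := bip_kempe_avoid pr xa xb yb ya.
  have ab : a != b by apply: contraNneq xa => ->.
  have cO := kempe_closedP (bip_ends_card F') pr (c := a) yb.
  exists (kempe_swap (bip_ends F') col a b (kempe (bip_ends F') col a b (inr (r e0)))), a.
  split=> //.
  - exact: kempe_swap_proper.
  - by move=> e /colk ek; rewrite /kempe_swap; do ![case: ifP => _].
  - by rewrite kempe_swap_coverE // (negbTE xO).
  - by rewrite kempe_swap_coverE // kempe_refl eqxx.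
exists (fun e => if e == e0 then c else col1 e) => [e f ef|e eF]; last first.
  by case: eqVneq => // ee0; apply: colk1; rewrite !inE ee0.
have SF e1 : e1 != e0 -> bip_ends F e1 = bip_ends F' e1.
  by move=> H; rewrite /bip_ends !inE H.
have disj e1 : c = col1 e1 -> e1 != e0 -> [disjoint bip_ends F e0 & bip_ends F e1].
  move=> cc ee; rewrite (SF e1) // {1}/bip_ends e0F.
  apply/pred0Pn => -[w /=]; rewrite !inE => /andP [/orP [] /eqP -> we].
    by case/negP: xc; apply/cover_byP; exists e1.
  by case/negP: yc; apply/cover_byP; exists e1.
case: (eqVneq e e0) ef => [->|ee0] ef; case: (eqVneq f e0) ef => [->|fe0] ef //.
- by move=> cf; apply: disj.
- by move=> cf; rewrite disjoint_sym; apply: disj.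
- by move=> cf; rewrite !SF //; apply: pr1.
Qed.

Lemma bip_proper_neq F (col : E -> nat) e f : proper_col (bip_ends F) col ->
  e \in F -> f \in F -> e != f -> (l e == l f) || (r e == r f) -> col e != col f.
Proof.
move=> pr eF fF ef; apply: contraL => /eqP /(pr _ _ ef) dis.
apply/norP; split; apply/negP => /eqP E1.
  by move/pred0P/(_ (inl (l e))): dis; rewrite /= !mem_bip_ends_l eF fF E1 !eqxx.
by move/pred0P/(_ (inr (r e))): dis; rewrite /= !mem_bip_ends_r eF fF E1 !eqxx.
Qed.

Definition bip_matching (M : {set E}) :=
  forall e f, e \in M -> f \in M -> e != f -> l e != l f /\ r e != r f.

Variable p : E -> nat.

(** An orientation of the line graph: [f] is preferred to [e] at a common end. *)
Definition bip_dominates f e :=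
  (l f == l e) && (p e < p f) || (r f == r e) && (p f < p e).

(* A stable matching: left vertices prefer large [p], right vertices small [p]. If
   the favourites of two left vertices meet, the one that the right vertex likes
   less can be deleted. *)
Lemma bip_kernel (F : {set E}) :
  (forall e f, e \in F -> f \in F -> e != f ->
     (l e == l f) || (r e == r f) -> p e != p f) ->
  exists M : {set E}, [/\ M \subset F, bip_matching M
    & forall e, e \in F -> e \notin M -> exists2 f, f \in M & bip_dominates f e].
Proof.
elim: {F}#|F| {-2}F (leqnn #|F|) => [|m IH] F.
  rewrite leqn0 cards_eq0 => /eqP -> _; exists set0; split=> //.
  - by move=> e f; rewrite inE.
  - by move=> e; rewrite inE.
move=> cF pF.
pose top e := (e \in F) && [forall f in F, (l f == l e) ==> (p f <= p e)].
have topP e f : top e -> f \in F -> l f = l e -> p f <= p e.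
  by case/andP=> _ /forall_inP H /H /implyP + E1; apply; rewrite E1.
case: (boolP [exists e, exists f, [&& top e, top f, r e == r f & p e < p f]]).
  case/existsP=> e /existsP [f /and4P [te tf /eqP ref pef]].
  have fF : f \in F by case/andP: tf.
  have eF : e \in F by case/andP: te.
  have sF : F :\ f \subset F by apply: subsetDl.
  have [||M [MF mM dM]] := IH (F :\ f).
  - by move: cF; rewrite (cardsD1 f) fF.
  - by move=> e1 e2 /(subsetP sF) H1 /(subsetP sF) H2; apply: pF.
  exists M; split=> //; first exact: subset_trans MF sF.
  move=> e1 e1F e1M; have [->|e1f] := eqVneq e1 f; last by apply: dM; rewrite // !inE e1f.
  (* The deleted [f] is dominated by [e] if [e] is in [M]. Otherwise [e], a favourite at its left
     end, is dominated at its right end, by an edge that dominates [f] as well. *)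
  have [eM|eM] := boolP (e \in M).
    by exists e; rewrite // /bip_dominates ref pef eqxx orbT.
  have e'F : e \in F :\ f by rewrite !inE eF andbT; apply: contraTneq pef => ->; rewrite ltnn.
  have [g gM] := dM e e'F eM; case/orP=> /andP [/eqP ge pge].
    have gF : g \in F by apply: (subsetP sF); apply: (subsetP MF).
    by have := topP _ _ te gF ge; lia.
  by exists g; rewrite // /bip_dominates ge ref eqxx (ltn_trans pge pef) orbT.
(* Favourites of distinct left vertices no longer meet, so they form the matching. *)
move=> ntop; exists [set e | top e]; split.
- by apply/subsetP => e; rewrite inE => /andP [].
- move=> e f; rewrite !inE => te tf ef.
  have [[eF _] [fF _]] := (andP te, andP tf).
  split; apply/negP => /eqP E1.
    have := pF e f eF fF ef; rewrite E1 eqxx => /(_ isT).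
    have := topP _ _ te fF (esym E1); have := topP _ _ tf eF E1; lia.
  have := pF e f eF fF ef; rewrite E1 eqxx orbT => /(_ isT).
  rewrite neq_ltn => /orP [] pp; case/negP: ntop; apply/existsP.
    by exists e; apply/existsP; exists f; rewrite te tf E1 eqxx pp.
  by exists f; apply/existsP; exists e; rewrite te tf E1 eqxx pp.
- move=> e eF; rewrite inE => te.
  have Pe : (e \in F) && (l e == l e) by rewrite eF eqxx.
  case: (@arg_maxnP _ e (fun f => (f \in F) && (l f == l e)) p Pe) => f /andP [fF /eqP fe] fmax.
  have tf : top f.
    rewrite /top fF; apply/forall_inP => g gF; apply/implyP => /eqP gf.
    by apply: fmax; rewrite gF gf fe eqxx.
  exists f; rewrite ?inE // /bip_dominates fe eqxx /=.
  have pef : p e <= p f := fmax e Pe.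
  apply/orP; left; rewrite ltn_neqAle pef andbT.
  have ef : e != f by apply: contraNneq te => ->.
  by apply: pF; rewrite ?fe ?eqxx.
Qed.

End Bipartite.

(** * From stable matchings to list colourings *)

Section Galvin.
Variables (E X Y C : finType) (l : E -> X) (r : E -> Y) (c0 : C).

(** Choose a colour [c] and give it to a stable matching [M] among the edges with [c] in their
    lists. Every other such edge loses [c] from its list but also loses a dominating edge, so the
    strict inequality survives for [F :\: M]. *)
Lemma bip_kernel_list_coloring (p : E -> nat) (F : {set E}) (L : E -> {set C}) :
  (forall e f, e \in F -> f \in F -> e != f ->
     (l e == l f) || (r e == r f) -> p e != p f) ->
  (forall e, e \in F -> #|[set f in F | bip_dominates l r p f e]| < #|L e|) ->
  exists2 phi : E -> C, forall e, e \in F -> phi e \in L e &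
    forall e f, e \in F -> f \in F -> e != f ->
      (l e == l f) || (r e == r f) -> phi e != phi f.
Proof.
elim: {F}#|F| {-2}F (leqnn #|F|) L => [|m IH] F.
  rewrite leqn0 cards_eq0 => /eqP -> L _ _.
  by exists (fun=> c0) => [e|e f]; rewrite inE.
move=> cF L pF LF; have [F0|[e0 e0F]] := set_0Vmem F.
  by exists (fun=> c0) => [e|e f]; rewrite F0 inE.
have /card_gt0P [c cL] : 0 < #|L e0| by apply: leq_trans (LF e0 e0F).
pose Fc := [set e in F | c \in L e].
have sFc : Fc \subset F by apply/subsetP => e; rewrite inE => /andP [].
have [|M [MF mM dM]] := @bip_kernel _ _ _ l r p Fc.
  by move=> e f /(subsetP sFc) H1 /(subsetP sFc) H2; apply: pF.
have MF' := subset_trans MF sFc.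
have e0c : e0 \in Fc by rewrite inE e0F.
(* [M] is nonempty, so the induction advances: [e0] lies in it or is dominated from it. *)
have [e1 e1M] : exists e1, e1 \in M.
  have [e0M|e0M] := boolP (e0 \in M); first by exists e0.
  by have [f fM _] := dM _ e0c e0M; exists f.
pose F' := F :\: M.
have sF' : F' \subset F by apply: subsetDl.
have [|||phi phiL phiP] := IH F' _ (fun e => L e :\ c).
- rewrite -ltnS; apply: leq_trans cF; apply: proper_card; apply/properP.
  by split=> //; exists e1; rewrite ?(subsetP MF') // !inE e1M.
- by move=> e f /(subsetP sF') H1 /(subsetP sF') H2; apply: pF.
- move=> e eF'; have eF := subsetP sF' _ eF'.
  have := LF e eF; rewrite (cardsD1 c (L e)).
  have sub : [set f in F' | bip_dominates l r p f e] \subset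
             [set f in F | bip_dominates l r p f e].
    by apply/subsetP => f; rewrite !inE => /andP [/andP [_ ->] ->].
  have [cLe|_] := boolP (c \in L e); last first.
    by rewrite add0n; apply: leq_ltn_trans; apply: subset_leq_card.
  rewrite add1n ltnS; apply: leq_trans; apply: proper_card; apply/properP.
  split=> //; have [||f fM fe] := dM e.
  + by rewrite inE eF.
  + by move: eF'; rewrite inE => /andP [].
  by exists f; rewrite !inE ?fM // (subsetP MF') ?fM.
exists (fun e => if e \in M then c else phi e) => [e eF|e f eF fF ef lr].
  case: ifPn => eM; first by move/(subsetP MF): eM; rewrite inE => /andP [].
  by have := phiL e; rewrite !inE eF eM => /(_ isT) /andP [].
have Nc g : g \in F -> g \notin M -> phi g != c.
  by move=> gF gM; have := phiL g; rewrite !inE gF gM => /(_ isT) /andP [].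
case: ifPn => eM; case: ifPn => fM.
- by have [/negbTE l1 /negbTE r1] := mM e f eM fM ef; rewrite l1 r1 in lr.
- by rewrite eq_sym; apply: Nc.
- exact: Nc.
- by apply: phiP; rewrite ?inE ?eM ?fM.
Qed.

Theorem galvin k (F : {set E}) (L : E -> {set C}) :
  (forall x, #|[set e in F | l e == x]| <= k) ->
  (forall y, #|[set e in F | r e == y]| <= k) ->
  (forall e, e \in F -> k <= #|L e|) ->
  exists2 phi : E -> C, forall e, e \in F -> phi e \in L e &
    forall e f, e \in F -> f \in F -> e != f ->
      (l e == l f) || (r e == r f) -> phi e != phi f.
Proof.
move=> dl dr kL; have [p pr pk] := konig_edge_coloring dl dr.
have pF e f : e \in F -> f \in F -> e != f ->
    (l e == l f) || (r e == r f) -> p e != p f by apply: bip_proper_neq.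
apply: (bip_kernel_list_coloring pF) => e eF; apply: leq_trans (kL e eF).
(* Dominating edges at the left end have distinct colours above [p e], those at
   the right end distinct colours below [p e]. *)
have pinj : {in [set f in F | bip_dominates l r p f e] &, injective p}.
  move=> f g; rewrite !inE => /andP [fF fd] /andP [gF gd] pfg.
  apply/eqP; apply: contraT => fg; have := pF f g fF gF fg.
  rewrite pfg eqxx; apply; move: fd gd; rewrite /bip_dominates pfg.
  by case/orP=> /andP [/eqP -> H1] /orP [] /andP [/eqP -> H2]; rewrite ?eqxx ?orbT //; lia.
have ek : p e \in iota 0 k by rewrite mem_iota /= add0n pk.
rewrite -(size_iota 0 k) (perm_size (perm_to_rem ek)) /= ltnS.
rewrite cardE -(size_map p); apply: uniq_leq_size.
  rewrite map_inj_in_uniq ?enum_uniq // => f g.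
  by rewrite !mem_enum; apply: pinj.
move=> _ /mapP [f fd ->]; move: fd; rewrite mem_enum inE => /andP [fF fd].
rewrite mem_rem_uniq ?iota_uniq // !inE mem_iota /= add0n pk // andbT.
by move: fd; rewrite /bip_dominates; lia.
Qed.

End Galvin.

(** * Balanced colourings *)

Lemma greedy_list_coloring (T E C : finType) (S : E -> {set T}) (L : E -> {set C}) :
  (forall e, #|[set f | (f != e) && ~~ [disjoint S e & S f]]| < #|L e|) ->
  exists2 col : E -> C, proper_col S col & forall e, col e \in L e.
Proof.
move=> LS; have L0 e : exists c, c \in L e.
  by apply/card_gt0P; exact: leq_trans (LS e).
have [col0 col0L] := fin_all_exists L0.
suff H (F : {set E}) : exists2 col : E -> C,
    {in F &, forall e f, e != f -> col e = col f -> [disjoint S e & S f]}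
    & forall e, col e \in L e.
  by have [col pr Lc] := H setT; exists col => // e f; apply: pr; rewrite inE.
elim: {F}#|F| {-2}F (leqnn #|F|) => [|m IH] F.
  rewrite leqn0 cards_eq0 => /eqP ->.
  by exists col0 => // e f; rewrite inE.
move=> cF; have [F0|[e0 e0F]] := set_0Vmem F.
  by exists col0 => // e f; rewrite F0 inE.
have [|col pr Lc] := IH (F :\ e0); first by move: cF; rewrite (cardsD1 e0) e0F.
have [|c] := @exists_notin _ (enum (L e0))
  [seq col f | f in [set f | (f != e0) && ~~ [disjoint S e0 & S f]]] (enum_uniq _).
  by rewrite size_map -!cardE.
rewrite mem_enum => cL cN.
have cdis f : f != e0 -> c = col f -> [disjoint S e0 & S f].
  move=> fe cf; apply: contraNT cN => dis; rewrite cf; apply: image_f.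
  by rewrite inE fe.
exists (fun e => if e == e0 then c else col e) => [e f eF fF|e]; last by case: eqP => [->|].
case: (eqVneq e e0) => [->|ee0] ef; case: (eqVneq f e0) ef => [->|fe0] ef //.
- exact: cdis.
- by move=> cf; rewrite disjoint_sym; apply: cdis.
- by apply: pr; rewrite // !inE ?ee0 ?fe0.
Qed.

(** Items of weight two are placed one at a time. The total stays within [#|Y| * k], so before each
    placement some [y] has load at most [k], and afterwards at most [k + 2]. *)
Lemma balanced_assignment (I J : finType) (F : {set I}) (Y : {set J})
    (base : J -> nat) k :
  0 < #|Y| ->
  \sum_(y in Y) base y + 2 * #|F| <= #|Y| * k ->
  (forall y, y \in Y -> base y <= k.+2) ->
  exists2 m : I -> J, forall i, m i \in Y &
    forall y, y \in Y -> base y + 2 * #|[set i in F | m i == y]| <= k.+2.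
Proof.
move=> /card_gt0P [y0 y0Y].
elim: {F}#|F| {-2}F (erefl #|F|) => [|s IH] F.
  move/eqP; rewrite cards_eq0 => /eqP -> _ bk; exists (fun=> y0) => // y yY.
  rewrite (_ : [set _ in _ | _] = set0) ?cards0 ?addn0 ?bk //.
  by apply/setP => i; rewrite !inE.
move=> cF tot bk; have [F0|[i0 i0F]] := set_0Vmem F; first by rewrite F0 cards0 in cF.
have cF' : #|F :\ i0| = s by move: cF; rewrite (cardsD1 i0) i0F => -[].
have [|m mY mk] := IH (F :\ i0) cF' _ bk; first by rewrite cF' in tot *; lia.
pose ld y := base y + 2 * #|[set i in F :\ i0 | m i == y]|.
have tot' : \sum_(y in Y) ld y + 2 <= #|Y| * k.
  rewrite /ld big_split /= -big_distrr /=.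
  suff -> : \sum_(y in Y) #|[set i in F :\ i0 | m i == y]| = s by lia.
  rewrite -cF' -sum1_card (partition_big m (mem Y)) => [|i _] //=.
  by apply: eq_bigr => y _; rewrite -sum1_card; apply: eq_bigl => i; rewrite inE.
have [y1 y1Y ldy1] : exists2 y1, y1 \in Y & ld y1 <= k.
  apply/exists_inP; apply: contraT; rewrite negb_exists_in => /forall_inP H.
  have : #|Y| * k <= \sum_(y in Y) ld y.
    rewrite -sum_nat_const; apply: leq_sum => y /H; rewrite -ltnNge; exact: ltnW.
  by lia.
exists (fun i => if i == i0 then y1 else m i) => [i|y yY]; first by case: eqP.
have [yy1|yy1] := eqVneq y y1.
  apply: leq_trans (_ : ld y1 + 2 <= _); last by lia.
  rewrite yy1 /ld -addnA leq_add2l.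
  suff : #|[set i in F | (if i == i0 then y1 else m i) == y1]| <=
         #|[set i in F :\ i0 | m i == y1]| + 1 by lia.
  rewrite addn1 -add1n (cardsD1 i0); apply: leq_add; first exact: leq_b1.
  apply: subset_leq_card; apply/subsetP => i; rewrite !inE => /andP [ii0].
  by rewrite (negbTE ii0).
apply: leq_trans (mk y yY); rewrite leq_add2l leq_mul2l /=.
apply: subset_leq_card; apply/subsetP => i; rewrite !inE.
by case: (eqVneq i i0) => [_ |_ //]; rewrite eq_sym (negbTE yy1) andbF.
Qed.

Section BalancedColoring.
Variables (T E C : finType) (S : E -> {set T}).
Hypothesis S2 : forall e, #|S e| <= 2.

Definition cover_energy (col : E -> C) := \sum_c #|cover_by S col c| ^ 2.

(** Moving [x] points between covers of sizes [u] and [w] lowers the sum of squares by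
    [2 x (u - w - x)], which is positive because [x <= 2 < u - w]. *)
Lemma cover_energy_decr (col col' : E -> C) c c' (X : {set T}) :
  0 < #|X| <= 2 -> X \subset cover_by S col c -> [disjoint X & cover_by S col c'] ->
  cover_by S col' c = cover_by S col c :\: X ->
  cover_by S col' c' = cover_by S col c' :|: X ->
  (forall k, k != c -> k != c' -> cover_by S col' k = cover_by S col k) ->
  #|cover_by S col c'| + 2 < #|cover_by S col c| ->
  cover_energy col' < cover_energy col.
Proof.
move=> X2 Xc Xc' Uc Uc' Uk lt.
have cc' : c' != c by apply: contraTneq lt => ->; lia.
rewrite /cover_energy (bigD1 c) // [X in _ < X](bigD1 c) //=.
rewrite (bigD1 c') // [X in _ < _ + X](bigD1 c') //=.
rewrite (eq_bigr (fun k => #|cover_by S col k| ^ 2)); last first.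
  by move=> k /andP [kc kc']; rewrite Uk.
have E1 : #|cover_by S col' c| = #|cover_by S col c| - #|X|.
  by rewrite Uc cardsD (setIidPr Xc).
have E2 : #|cover_by S col' c'| = #|cover_by S col c'| + #|X|.
  rewrite Uc' cardsU; move: Xc'; rewrite disjoint_sym -setI_eq0 => /eqP ->.
  by rewrite cards0 subn0.
have Xle := subset_leq_card Xc.
rewrite E1 E2 !addnA ltn_add2r.
move: (#|X|) (#|cover_by S col c|) (#|cover_by S col c'|) X2 lt Xle => x u w.
case: x => [|[|[|x]]] // _ wu _; have [t ->] : exists t, u = w + 3 + t by exists (u - w - 3); lia.
  by rewrite (_ : w + 3 + t - 1 = w + 2 + t); nia.
by rewrite (_ : w + 3 + t - 2 = w + 1 + t); nia.
Qed.

(** If every chain from a point covered by [c] alone reached a point covered by [c'] alone, these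
    far ends would give an injection of the first kind of points into the second, of which there are
    fewer. *)
Lemma exists_kempe_gain (col : E -> C) c c' : proper_col S col ->
  #|cover_by S col c'| < #|cover_by S col c| ->
  exists v, [/\ v \in cover_by S col c, v \notin cover_by S col c' &
    [disjoint kempe S col c c' v & cover_by S col c' :\: cover_by S col c]].
Proof.
move=> pr lt; pose P := cover_by S col c :\: cover_by S col c'.
pose Q := cover_by S col c' :\: cover_by S col c.
have QP : #|Q| < #|P|.
  rewrite /P /Q !cardsD [_ :&: cover_by S col c]setIC.
  have := subset_leq_card (subsetIl (cover_by S col c) (cover_by S col c')).
  by have := subset_leq_card (subsetIr (cover_by S col c) (cover_by S col c')); lia.
case: (boolP [exists v in P, [disjoint kempe S col c c' v & Q]]).
  by case/exists_inP => v /setDP [vc vc'] H; exists v.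
rewrite negb_exists_in => /forall_inP H.
pose q v := odflt v [pick w in kempe S col c c' v :&: Q].
have qP v : v \in P -> q v \in kempe S col c c' v :&: Q.
  move=> /H /pred0Pn [w /= /andP [w1 w2]]; rewrite /q; case: pickP => //= /(_ w).
  by rewrite in_setI w1 w2.
have qinj : {in P &, injective q}.
  (* The common value [q v] puts [v] and [w] on one chain, whose only other end is [q v]; as [w] is
     covered by [c] and [q v] is not, [w] is [v]. *)
  move=> v w vP wP qvw; have /setIP [qv qQ] := qP v vP; have /setIP [qw _] := qP w wP.
  rewrite -qvw in qw; have eqK := kempe_eq S2 pr qv qw.
  have /setDP [vc vc'] := vP; have /setDP [wc wc'] := wP; have /setDP [zc' zc] := qQ.
  have [m [_ Hm]] := kempe_ends S2 pr c vc'.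
  have wK : w \in kempe S col c c' v by rewrite eqK kempe_refl.
  have qm : q v = m.
    have [|E1|//] := Hm _ qv; first by rewrite inE (negbTE zc).
    by rewrite E1 vc in zc.
  have [|//|E1] := Hm _ wK; first by rewrite inE (negbTE wc') andbF.
  by rewrite qm -E1 wc in zc.
move: QP; rewrite ltnNge -(card_in_imset qinj) subset_leq_card //.
by apply/subsetP => _ /imsetP [v vP ->]; have /setIP [] := qP v vP.
Qed.

Variables (side : C -> bool) (ok : E -> C -> bool).
Hypothesis ok_side : forall e c c', side c = side c' -> ok e c -> ok e c'.

(** Descent on the energy with two moves: a Kempe swap between colours of the same side, and the
    recolouring of a single two-element set. A colouring that admits no improving move satisfies
    both inequalities. *)
Lemma balanced_coloring (col0 : E -> C) :
  proper_col S col0 -> (forall e, ok e (col0 e)) ->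
  exists col : E -> C, [/\ proper_col S col, forall e, ok e (col e),
    forall c c', side c = side c' ->
      #|cover_by S col c| <= #|cover_by S col c'| + 2
  & forall e c', #|S e| = 2 -> ok e c' -> [disjoint S e & cover_by S col c'] ->
      #|cover_by S col (col e)| <= #|cover_by S col c'| + 2].
Proof.
elim: {col0}(cover_energy col0) {-2}col0 (leqnn (cover_energy col0)) => [|s IH] col en pr okc.
  have U0 c : #|cover_by S col c| = 0.
    move: en; rewrite leqn0 sum_nat_eq0 => /forallP /(_ c).
    by rewrite expn_eq0 andbT => /eqP.
  by exists col; split=> // *; rewrite !U0.
case: (boolP [exists c, exists c', (side c == side c') &&
    (#|cover_by S col c'| + 2 < #|cover_by S col c|)]).
  case/existsP=> c /existsP [c' /andP [/eqP sc lt]].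
  have [|v [vc vc' dis]] := @exists_kempe_gain col c c' pr; first by lia.
  set O := kempe S col c c' v in dis.
  have cO : kempe_closed S col c c' O by apply: kempe_closedP.
  have ncc' : c != c' by apply: contraTneq lt => ->; lia.
  have [m [_ Hm]] := kempe_ends S2 pr c vc'.
  have vO : v \in O by apply: kempe_refl.
  rewrite -/O in Hm; clearbody O.
  have inO w : w \in O -> w \in cover_by S col c' -> w \in cover_by S col c.
    move=> wO wc'; apply: contraT => wc.
    by move/pred0P/(_ w): dis; rewrite /= in_setD wO wc' wc.
  (* The swap transfers exactly [X] from [c] to [c']: every other point of [O] is covered by both
     colours or by neither. Only the ends [v] and [m] of the chain can lie in [X]. *)
  pose X := (cover_by S col c :\: cover_by S col c') :&: O.
  have c'c : c' != c by rewrite eq_sym.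
  apply: (IH (kempe_swap S col c c' O)).
  - rewrite -ltnS; apply: leq_trans en.
    apply: (@cover_energy_decr _ _ c c' X) => //.
    + apply/andP; split; first by apply/card_gt0P; exists v; rewrite !inE vc vc'.
      apply: leq_trans (_ : #|[set v; m]| <= 2); last by rewrite cards2 ltnS leq_b1.
      apply: subset_leq_card; apply/subsetP => w /setIP [/setDP [wc wc'] wO].
      have [|->|->] := Hm w wO; rewrite !inE ?eqxx ?orbT //.
      by rewrite (negbTE wc') andbF.
    + by apply/subsetP => w /setIP [/setDP []].
    + apply/pred0P => w /=; apply/negP => /andP [/setIP [/setDP [_ /negP]]] //.
    + apply/setP => w; rewrite kempe_swap_coverE // eqxx !inE.
      case: ifPn => wO; last by rewrite andbF.
      by have := inO w wO; case: (w \in cover_by S col c); case: (w \in cover_by S col c') => // ->.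
    + apply/setP => w; rewrite kempe_swap_coverE // eqxx (negbTE c'c) !inE.
      case: ifPn => wO; last by rewrite andbF orbF.
      by have := inO w wO; case: (w \in cover_by S col c); case: (w \in cover_by S col c') => // ->.
    + move=> k kc kc'; apply/setP => w; rewrite kempe_swap_coverE //.
      by rewrite (negbTE kc) (negbTE kc') if_same.
  - exact: kempe_swap_proper.
  - move=> e; rewrite /kempe_swap; case: ifP => // _.
    case: eqP => [E1|_]; first by apply: ok_side (okc e); rewrite E1.
    by case: eqP => // E1; apply: ok_side (okc e); rewrite E1.
rewrite negb_exists => /forallP H1.
case: (boolP [exists e, exists c', [&& #|S e| == 2, ok e c',
    [disjoint S e & cover_by S col c'] &
    (#|cover_by S col c'| + 2 < #|cover_by S col (col e)|)]]).
  case/existsP=> e /existsP [c' /and4P [/eqP Se okec' dis lt]].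
  have ec' : c' != col e by apply: contraTneq lt => ->; lia.
  pose col' f := if f == e then c' else col f.
  have Se_sub : S e \subset cover_by S col (col e).
    by apply/subsetP => w we; apply/cover_byP; exists e.
  apply: (IH col').
  - rewrite -ltnS; apply: leq_trans en.
    apply: (@cover_energy_decr _ _ (col e) c' (S e)) => //; first by rewrite Se.
    + apply/setP => w; rewrite in_setD; apply/cover_byP/andP => [[f]|[we /cover_byP [f fe wf]]].
        rewrite /col'; case: eqP => [_ E1|/eqP fe E1 wf]; first by rewrite E1 eqxx in ec'.
        split; last by apply/cover_byP; exists f.
        by have /disjointFr -> := pr f e fe E1.
      exists f => //; rewrite /col'; case: eqP => // E1.
      by rewrite E1 in wf; rewrite wf in we.
    + apply/setP => w; rewrite in_setU; apply/cover_byP/orP => [[f]|[/cover_byP [f fc' wf]|we]].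
      * rewrite /col'; case: eqP => [->|_ E1 wf]; first by right.
        by left; apply/cover_byP; exists f.
      * by exists f => //; rewrite /col'; case: eqP.
      * by exists e => //; rewrite /col' eqxx.
    + move=> k ke kc'; apply/setP => w; apply/cover_byP/cover_byP => [[f]|[f fk wf]].
        rewrite /col'; case: eqP => [_ E1|_ E1 wf]; last by exists f.
        by rewrite E1 eqxx in kc'.
      exists f => //; rewrite /col'; case: eqP => // E1.
      by rewrite -fk E1 eqxx in ke.
  - have disf f : c' = col f -> [disjoint S e & S f].
      move=> fc'; apply: disjointWr dis; apply/subsetP => w wf.
      by apply/cover_byP; exists f.
    move=> f g; rewrite /col'.
    case: (eqVneq f e) => [->|fe]; case: (eqVneq g e) => [->|ge] // fg E1.
    + exact: disf.
    + by rewrite disjoint_sym; apply: disf.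
    + exact: pr.
  - by move=> f; rewrite /col'; case: eqP => [->|].
rewrite negb_exists => /forallP H2; exists col; split=> // [c c' sc|e c' Se okec' dis].
  have := H1 c; rewrite negb_exists => /forallP /(_ c').
  by rewrite sc eqxx /= -leqNgt.
have := H2 e; rewrite negb_exists => /forallP /(_ c').
by rewrite Se okec' dis eqxx /= -leqNgt.
Qed.

End BalancedColoring.

(** * Routing the demands *)

Lemma sum_card_setI (T E : finType) (S : E -> {set T}) (Z : {set T}) :
  \sum_e #|S e :&: Z| = \sum_(t in Z) #|[set e | t \in S e]|.
Proof.
rewrite (eq_bigr (fun e => \sum_(t in Z) (t \in S e))); last first.
  move=> e _; rewrite -sum1_card [RHS]big_mkcond [LHS]big_mkcond.
  by apply: eq_bigr => t _; rewrite inE; case: (t \in S e); case: (t \in Z).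
rewrite exchange_big; apply: eq_bigr => t _; rewrite -sum1_card [RHS]big_mkcond.
by apply: eq_bigr => e _; rewrite inE; case: (t \in S e).
Qed.

Definition parity_class n (s : bool) : {set 'I_n} := [set b : 'I_n | odd b == s].

Lemma card_parity_class n s :
  #|parity_class n s| = if s then n./2 else uphalf n.
Proof.
rewrite -sum1_card big_mkcond (eq_bigr (fun b : 'I_n => nat_of_bool (odd b == s))).
  elim: n => [|n IH]; first by rewrite big_ord0; case: (s).
  by rewrite big_ord_recr /= IH uphalf_half; case: (s); case: (odd n); lia.
by move=> b _; rewrite inE; case: eqP.
Qed.

(** * Colouring the demands and choosing the hubs *)

Section Demand.
Variables (n d : nat) (D : multigraph ('I_n + 'I_n)%type).
Hypotheses (dn : 4 * d + 18 <= n) (deg : forall v, mg_degree D v <= d).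
Let E := mg_edge D.

Definition rows (e : E) : {set 'I_n} := [set a | inl a \in mg_ends e].
Definition cols (e : E) : {set 'I_n} := [set b | inr b \in mg_ends e].

Lemma card_rows_cols e : #|rows e| + #|cols e| = 2.
Proof.
rewrite -(mg_loopless e) -!sum1_card [RHS]big_mkcond big_sumType /=.
by congr (_ + _); rewrite [LHS]big_mkcond; apply: eq_bigr => a _; rewrite inE.
Qed.

Lemma row_degree a : #|[set e | a \in rows e]| <= d.
Proof.
apply: leq_trans (deg (inl a)); apply: subset_leq_card.
by apply/subsetP => e; rewrite !inE.
Qed.

Lemma col_degree b : #|[set e | b \in cols e]| <= d.
Proof.
apply: leq_trans (deg (inr b)); apply: subset_leq_card.
by apply/subsetP => e; rewrite !inE.
Qed.

Lemma sum_card_cols s : \sum_e #|cols e :&: parity_class n s| <= #|parity_class n s| * d.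
Proof.
rewrite sum_card_setI -sum_nat_const; apply: leq_sum => b _; exact: col_degree.
Qed.

Lemma card_row_neighbours e : #|[set f | ~~ [disjoint rows e & rows f]]| <= 2 * d.
Proof.
have sub : [set f | ~~ [disjoint rows e & rows f]] \subset
    \bigcup_(a in rows e) [set f | a \in rows f].
  apply/subsetP => f; rewrite inE => /pred0Pn [a /andP [/= ae af]].
  by apply/bigcupP; exists a => //; rewrite inE.
apply: leq_trans (subset_leq_card sub) _.
apply: leq_trans (_ : \sum_(a in rows e) d <= _).
  elim/big_ind2: _ => [|m1 A1 m2 A2 H1 H2|a _]; rewrite ?cards0 ?row_degree //.
  by rewrite (leq_trans (leq_card_setU _ _)) // leq_add.
by rewrite sum_nat_const leq_mul2r; have := card_rows_cols e; lia.
Qed.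

(** Only a demand with one end in each class is restricted: its end in [B] and its hub must lie in
    different halves, to keep the later pairs bipartite. *)
Definition admissible (e : E) (c : 'I_n) :=
  (#|rows e| == 1) ==> [forall b in cols e, odd b != odd c].

Lemma card_half s : 2 * d + 9 <= #|parity_class n s|.
Proof. by rewrite card_parity_class; case: s; lia. Qed.

(** Greedy: a demand conflicts with at most [2 d] others, while either half offers at least
    [2 d + 9] colours. *)
Lemma exists_admissible_coloring :
  exists2 col : E -> 'I_n, proper_col rows col & forall e, admissible e (col e).
Proof.
have [|col pr ok] := @greedy_list_coloring _ E _ rows (fun e => [set c | admissible e c]).
  move=> e; apply: leq_trans (_ : 2 * d + 9 <= _).
    rewrite -addn1 leq_add //; apply: leq_trans (card_row_neighbours e).
    by apply: subset_leq_card; apply/subsetP => f; rewrite !inE => /andP [].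
  have [r1|r1] := eqVneq #|rows e| 1; last first.
    rewrite (_ : [set c | _] = setT) ?cardsT ?card_ord; first by lia.
    by apply/setP => c; rewrite !inE /admissible (negbTE r1).
  have /eqP/cards1P [b cb] : #|cols e| = 1 by have := card_rows_cols e; lia.
  apply: leq_trans (card_half (~~ odd b)) _; apply: subset_leq_card.
  apply/subsetP => c; rewrite !inE => /eqP cp; apply/implyP => _.
  by apply/forall_inP => b'; rewrite cb inE => /eqP ->; rewrite cp; case: (odd b).
by exists col => // e; have := ok e; rewrite inE.
Qed.

(** The average cover has at most [d] points. A cover of size [d + 7] would, by at most three
    comparisons each losing 2, force every cover above this average; hence the constant 6. *)
Lemma exists_balanced_row_coloring : exists col : E -> 'I_n,
  [/\ proper_col rows col, forall e, admissible e (col e)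
    & forall c, #|cover_by rows col c| <= d + 6].
Proof.
have [col0 pr0 ok0] := exists_admissible_coloring.
have rows2 e : #|rows e| <= 2 by have := card_rows_cols e; lia.
have ok_side e (c c' : 'I_n) : odd c = odd c' -> admissible e c -> admissible e c'.
  by rewrite /admissible => ->.
have [col [pr ok same recolor]] := balanced_coloring rows2 ok_side pr0 ok0.
pose U (c : 'I_n) := #|cover_by rows col c|.
have {}same (c c' : 'I_n) : odd c = odd c' -> U c <= U c' + 2 by apply: same.
exists col; split=> // c; rewrite -/(U c) leqNgt; apply/negP => big_c.
have near (c2 : 'I_n) : odd c2 = odd c -> d + 5 <= U c2.
  by move=> s; have := same c c2 (esym s); lia.
case: (boolP [exists e, (#|rows e| == 2) && (odd (col e) == odd c)]).
  case/existsP=> e /andP [/eqP re /eqP ec].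
  have [|c'] := @exists_notin _ (enum (parity_class n (~~ odd c)))
    [seq col f | f in [set f | ~~ [disjoint rows e & rows f]]] (enum_uniq _).
    rewrite size_map -!cardE; apply: leq_ltn_trans (card_row_neighbours e) _.
    by have := card_half (~~ odd c); lia.
  rewrite mem_enum inE => /eqP c'c c'N.
  have far (c2 : 'I_n) : d.+1 <= U c2.
    have H1 : U (col e) <= U c' + 2.
      apply: recolor => //; first by rewrite /admissible re.
      apply/pred0P => a /=; apply/negP => /andP [ae /cover_byP [f fc' af]].
      case/negP: c'N; rewrite -fc'; apply: image_f; rewrite inE.
      by apply/pred0Pn; exists a; rewrite /= ae.
    have H2 := near _ ec.
    have [s|s] := eqVneq (odd c2) (odd c); first by have := near _ s; lia.
    have := same c' c2; rewrite c'c => /(_ _) H3.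
    by have := H3 ltac:(by case: (odd c2) (odd c) s => [] []); lia.
  have : n * d.+1 <= \sum_c0 U c0.
    rewrite -{1}(card_ord n) -sum_nat_const; apply: leq_sum => c2 _; exact: far.
  have -> : \sum_c0 U c0 = \sum_e0 #|rows e0|.
    rewrite [RHS](partition_big col xpredT) //=.
    by apply: eq_bigr => c2 _; rewrite /U card_cover_by.
  have : \sum_e0 #|rows e0| <= n * d.
    rewrite (eq_bigr (fun e0 => #|rows e0 :&: setT|)); last by move=> *; rewrite setIT.
    have -> : n * d = \sum_(a in [set: 'I_n]) d by rewrite sum_nat_const cardsT card_ord.
    by rewrite sum_card_setI; apply: leq_sum => a _; exact: row_degree.
  by nia.
(* Now each point covered from this half belongs to a demand whose other end is in the opposite half
   of [B]. The degrees there are too small, since the halves differ by at most one. *)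
rewrite negb_exists => /forallP none.
have : #|parity_class n (odd c)| * (d + 5) <=
       \sum_(c2 in parity_class n (odd c)) U c2.
  rewrite -sum_nat_const; apply: leq_sum => c2; rewrite inE => /eqP; exact: near.
have -> : \sum_(c2 in parity_class n (odd c)) U c2 =
    \sum_(e | odd (col e) == odd c) #|rows e|.
  rewrite [RHS](partition_big col (mem (parity_class n (odd c)))) /= => [|e]; last by rewrite inE.
  apply: eq_bigr => c2; rewrite inE => /eqP c2c; rewrite /U card_cover_by //.
  by apply: eq_bigl => e; case: (eqVneq (col e) c2) => [->|]; rewrite ?c2c ?eqxx ?andbF.
have : \sum_(e | odd (col e) == odd c) #|rows e| <= #|parity_class n (~~ odd c)| * d.
  apply: leq_trans (sum_card_cols _); rewrite big_mkcond; apply: leq_sum => e _.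
  case: eqP => // ec; have := none e; rewrite ec eqxx andbT => r2.
  have := card_rows_cols e => rc.
  have [r1|r1] : #|rows e| = 1 \/ #|rows e| = 0 by move/eqP: r2; lia.
    have /eqP/cards1P [b cb] : #|cols e| = 1 by lia.
    rewrite r1 card_gt0; apply/set0Pn; exists b; rewrite cb !inE eqxx /=.
    have := ok e; rewrite /admissible r1 => /forall_inP /(_ b).
    by rewrite cb inE eqxx ec => /(_ isT); case: (odd b); case: (odd c).
  by rewrite r1.
rewrite !card_parity_class; case: (odd c) => /=; nia.
Qed.

(** The last clause bounds the pairs at a hub [y] that come from demands not ending at [y]. *)
Lemma exists_hubs : exists col hub : E -> 'I_n,
  [/\ proper_col rows col, forall c, #|cover_by rows col c| <= d + 6,
      forall e, rows e != set0 -> hub e = col e,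
      forall e x, x \in cols e -> x != hub e -> odd x != odd (hub e)
    & forall y, \sum_(e | (hub e == y) && (y \notin cols e)) #|cols e| <= d + 6].
Proof.
have [col [pr ok U6]] := exists_balanced_row_coloring.
pose base y := #|[set e | (#|rows e| == 1) && (col e == y)]|.
have base6 y : base y <= d + 6.
  apply: leq_trans (U6 y); rewrite card_cover_by // /base -sum1_card big_mkcond.
  rewrite [leqRHS]big_mkcond; apply: leq_sum => e _; rewrite inE.
  by case: (col e == y); rewrite ?andbF // andbT; case: eqP => // ->.
pose F s := [set e | (#|cols e| == 2) && (cols e \subset parity_class n s)].
have exm s : exists m : E -> 'I_n,
    (forall e, m e \in parity_class n (~~ s)) /\
    (forall y, y \in parity_class n (~~ s) ->
       base y + 2 * #|[set e in F s | m e == y]| <= d + 6).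
  have [||| m0 m0Y m0k] := @balanced_assignment E _ (F s) (parity_class n (~~ s)) base (d + 4).
  - by apply: leq_trans (card_half (~~ s)); rewrite addnS.
  (* A mixed demand with its hub in the half [~~ s] ends in the half [s], so base loads and new
     weights together are paid for by the degrees in the half [s]. The slack 4 absorbs the
     difference in size of the halves. *)
  - apply: leq_trans (_ : #|parity_class n s| * d <= _); last first.
      rewrite !card_parity_class uphalf_half; have: 2 * d + 9 <= n./2 by lia.
      by move: (n./2) => h; case: (odd n); case: s => /=; nia.
    apply: leq_trans (sum_card_cols s).
    have -> : \sum_(y in parity_class n (~~ s)) base y =
        #|[set e | (#|rows e| == 1) && (odd (col e) == ~~ s)]|.
      rewrite -[RHS]sum1_card (partition_big col (mem (parity_class n (~~ s)))) /=; last first.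
        by move=> e; rewrite !inE => /andP [].
      apply: eq_bigr => y; rewrite inE => ys; rewrite /base -sum1_card; apply: eq_bigl => e.
      rewrite !inE; case: (eqVneq (col e) y) => [->|_]; last by rewrite !andbF.
      by rewrite ys !andbT.
    rewrite -!sum1_card big_distrr /= big_mkcond [X in _ + X]big_mkcond -big_split /=.
    apply: leq_sum => e _; rewrite !inE.
    have rc := card_rows_cols e.
    have [r1|r1] := eqVneq #|rows e| 1.
      have c1 : #|cols e| = 1 by lia.
      rewrite c1 /= addn0; case: eqP => // cs.
      have /eqP/cards1P [b cb] := c1.
      rewrite card_gt0; apply/set0Pn; exists b; rewrite cb !inE eqxx /=.
      have := ok e; rewrite /admissible r1 => /forall_inP /(_ b).
      by rewrite cb inE eqxx cs => /(_ isT); case: (odd b); case: (s).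
    rewrite /= add0n; case: andP => // -[/eqP c2 sub].
    by rewrite (setIidPl sub) c2.
  - by move=> y _; have := base6 y; lia.
  by exists m0; split=> // y /m0k; rewrite -!addnS.
have [m mP] := fin_all_exists exm.
(* In the last case both ends lie in [B], in different halves, so an even end exists and the default
   [col e] is never taken. *)
pose hub e := if rows e != set0 then col e
  else if cols e \subset parity_class n true then m true e
  else if cols e \subset parity_class n false then m false e
  else odflt (col e) [pick b in cols e | ~~ odd b].
have mpar s e : odd (m s e) = ~~ s by have [/(_ e)] := mP s; rewrite inE => /eqP.
have cross e : rows e = set0 -> ~~ (cols e \subset parity_class n true) ->
    ~~ (cols e \subset parity_class n false) ->
    exists b b', [/\ cols e = [set b; b'], hub e = b, ~~ odd b & odd b'].
  move=> r0 ct cf; have /eqP/cards2P [b [b' [bb' cbb]]] : #|cols e| = 2.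
    by have := card_rows_cols e; rewrite r0 cards0.
  rewrite /hub r0 eqxx /= (negbTE ct) (negbTE cf).
  case: pickP => [x /andP [xc xo]|no] /=; last first.
    case/negP: ct; apply/subsetP => x xc; rewrite inE; have := no x; rewrite xc.
    by case: (odd x).
  have /subsetPn [z zc] := cf; rewrite inE eqbF_neg negbK => zo.
  exists x, z; split=> //; apply/esym/eqP; rewrite eqEcard; apply/andP; split.
    by apply/subsetP => w /set2P [] ->.
  rewrite cbb !cards2 (_ : x != z) ?leq_b1 //; first by case: (_ != _).
  by apply: contraNneq xo => ->.
exists col, hub; split=> //.
- by move=> e r0; rewrite /hub r0.
- move=> e x xc xh; have [r0|r0] := eqVneq (rows e) set0; last first.
    rewrite /hub r0; have := ok e; rewrite /admissible.
    have c0 : 0 < #|cols e| by apply/card_gt0P; exists x.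
    have -> : #|rows e| == 1.
      by have := card_rows_cols e; move: r0; rewrite -card_gt0; lia.
    by move/forall_inP; apply.
  have [ct|ct] := boolP (cols e \subset parity_class n true).
    rewrite /hub r0 eqxx /= ct mpar; move/subsetP/(_ x xc): ct; rewrite inE => /eqP ->.
    by [].
  have [cf|cf] := boolP (cols e \subset parity_class n false).
    rewrite /hub r0 eqxx /= (negbTE ct) cf mpar; move/subsetP/(_ x xc): cf.
    by rewrite inE => /eqP ->.
  have [b [b' [cE hb bo b'o]]] := cross e r0 ct cf.
  move: xc xh; rewrite cE hb !inE => /orP [] /eqP -> ; first by rewrite eqxx.
  by rewrite b'o (negbTE bo).
- move=> y; pose s := ~~ odd y.
  have ys : y \in parity_class n (~~ s) by rewrite inE negbK.
  apply: leq_trans ((mP s).2 y ys).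
  rewrite /base -!sum1_card big_distrr /= big_mkcond [X in X + _]big_mkcond.
  rewrite [X in _ + X]big_mkcond -big_split /=.
  apply: leq_sum => e _; rewrite !inE; case: andP => // -[/eqP hy yc].
  have rc := card_rows_cols e.
  have [r0|r0] := eqVneq (rows e) set0; last first.
    have [c0|c0] := eqVneq #|cols e| 0; first by rewrite c0.
    have r1 : #|rows e| = 1 by move: r0; rewrite -card_gt0; move/eqP: c0; lia.
    have hc : col e = y by rewrite -hy /hub r0.
    have c1 : #|cols e| = 1 by rewrite r1 in rc; case: rc.
    by rewrite c1 r1 hc !eqxx.
  have c2 : #|cols e| = 2 by rewrite r0 cards0 in rc.
  suff [cs ms] : cols e \subset parity_class n s /\ m s e == y.
    by rewrite cs ms c2 /= leq_addl.
  have [ct|ct] := boolP (cols e \subset parity_class n true).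
    have my : m true e = y by rewrite -hy /hub r0 eqxx /= ct.
    have -> : s = true by rewrite /s -my mpar.
    by rewrite my eqxx.
  have [cf|cf] := boolP (cols e \subset parity_class n false).
    have my : m false e = y by rewrite -hy /hub r0 eqxx /= (negbTE ct) cf.
    have -> : s = false by rewrite /s -my mpar.
    by rewrite my eqxx.
  have [b [b' [cE hb _ _]]] := cross e r0 ct cf.
  have : b \in cols e by rewrite cE !inE eqxx.
  by rewrite inE -hb hy (negbTE yc).
Qed.

(** * Connecting ends to hubs and assembling the paths *)

Section Realization.
Variables col hub : E -> 'I_n.
Hypotheses (pr : proper_col rows col)
  (U6 : forall c, #|cover_by rows col c| <= d + 6)
  (hub_col : forall e, rows e != set0 -> hub e = col e)
  (hub_odd : forall e x, x \in cols e -> x != hub e -> odd x != odd (hub e))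
  (load6 : forall y, \sum_(e | (hub e == y) && (y \notin cols e)) #|cols e| <= d + 6).

(** A pair [(e, x)] stands for the task of joining [x] to the hub of [e] through one vertex of
    [A]. *)
Definition stubs : {set E * 'I_n} := [set p | (p.2 \in cols p.1) && (p.2 != hub p.1)].

(** A demand ending at [v] contributes at most one stub at [v]: its own end, or the other end if [v]
    is the hub. The rest is the load bounded by [load6]. *)
Lemma stub_degree v :
  #|[set p in stubs | (p.2 == v) || (hub p.1 == v)]| <= 2 * d + 6.
Proof.
apply: leq_trans (_ : #|[set e | v \in cols e]| +
    \sum_(e | (hub e == v) && (v \notin cols e)) #|cols e| <= _); last first.
  by rewrite mul2n -addnn -addnA leq_add ?col_degree.
rewrite -!sum1_card big_mkcond [X in X + _]big_mkcond [X in _ + X]big_mkcond -big_split.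
rewrite (eq_bigr (fun p => nat_of_bool ((p.2 \in cols p.1) && (p.2 != hub p.1)
  && ((p.2 == v) || (hub p.1 == v))))); last by move=> p _; rewrite !inE; case: ifP.
rewrite -(pair_bigA _ (fun e x => nat_of_bool ((x \in cols e) && (x != hub e)
  && ((x == v) || (hub e == v))))) /=.
apply: leq_sum => e _; rewrite inE.
rewrite (_ : \sum_(j < n) _ =
    #|[set x in cols e | (x != hub e) && ((x == v) || (hub e == v))]|); last first.
  rewrite -sum1_card [RHS]big_mkcond; apply: eq_bigr => x _.
  by rewrite [in RHS]inE andbA; case: ifP.
have [hv|hv] := eqVneq (hub e) v; last first.
  rewrite addn0; case: ifPn => vc; last first.
    rewrite leqn0 cards_eq0; apply/eqP/setP => x; rewrite [in LHS]inE in_set0.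
    by case: (eqVneq x v) => [->|]; rewrite ?(negbTE vc) ?orbF ?andbF.
  rewrite -(cards1 v); apply: subset_leq_card; apply/subsetP => x.
  by rewrite [in X in X -> _]inE orbF in_set1 => /and3P [].
case: ifPn => vc /=.
  rewrite addn0; have : #|cols e| <= 2 by have := card_rows_cols e; lia.
  rewrite (cardsD1 v) vc add1n ltnS; apply: leq_trans; apply: subset_leq_card.
  by apply/subsetP => x; rewrite [in X in X -> _]inE in_setD1 hv => /and3P [-> -> _].
rewrite add0n; apply: subset_leq_card; apply/subsetP => x.
by rewrite [in X in X -> _]inE => /andP [].
Qed.

(** Galvin's theorem with odd vertices on the left and even ones on the right. The lists avoid the
    covers of both ends, so they have at least [n - 2 (d + 6) >= 2 d + 6] members; this is where
    [4 d + 18 <= n] is tight. *)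
Lemma exists_connectors : exists2 k : E * 'I_n -> 'I_n,
  forall p, p \in stubs -> (k p \notin cover_by rows col p.2) &&
                           (k p \notin cover_by rows col (hub p.1))
  & forall p q, p \in stubs -> q \in stubs -> p != q -> k p = k q ->
    [disjoint [set p.2; hub p.1] & [set q.2; hub q.1]].
Proof.
have n0 : 0 < n by lia.
pose l (p : E * 'I_n) := if odd p.2 then p.2 else hub p.1.
pose r (p : E * 'I_n) := if odd p.2 then hub p.1 else p.2.
pose L (p : E * 'I_n) := ~: (cover_by rows col p.2 :|: cover_by rows col (hub p.1)).
have [||| k kL kP] := @galvin _ _ _ _ l r (Ordinal n0) (2 * d + 6) stubs L.
- move=> v; apply: leq_trans (stub_degree v); apply: subset_leq_card.
  apply/subsetP => p; rewrite !inE => /andP [-> /=]; rewrite /l.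
  by case: ifP => _ ->; rewrite ?orbT.
- move=> v; apply: leq_trans (stub_degree v); apply: subset_leq_card.
  apply/subsetP => p; rewrite !inE => /andP [-> /=]; rewrite /r.
  by case: ifP => _ ->; rewrite ?orbT.
- move=> p _; rewrite /L cardsCs setCK card_ord.
  have := leq_card_setU (cover_by rows col p.2) (cover_by rows col (hub p.1)).
  have := leq_add (U6 p.2) (U6 (hub p.1)).
  move=> H1 H2; rewrite leq_subRL; last by apply: leq_trans H2 _; apply: leq_trans H1 _; lia.
  by apply: leq_trans (_ : (d + 6 + (d + 6)) + (2 * d + 6) <= _);
    [rewrite leq_add2r; apply: leq_trans H2 H1 | lia].
exists k => [p /kL|p q pF qF pq kpq].
  by rewrite /L in_setC in_setU negb_or.
have /eqP := kpq; apply: contraTT => /pred0Pn [x /andP [/= xp xq]].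
apply: kP => //; rewrite /l /r.
(* Parity fixes the side of a vertex, so stubs sharing a vertex share their [l] or their [r]. *)
have stub_odd (p' : E * 'I_n) : p' \in stubs -> odd p'.2 = ~~ odd (hub p'.1).
  by rewrite inE => /andP [c1 /(hub_odd c1)]; case: (odd p'.2); case: (odd (hub p'.1)).
have [op oq] := (stub_odd p pF, stub_odd q qF).
move: xp xq => /set2P [] -> /set2P [] E1.
- by rewrite E1; case: (odd q.2); rewrite eqxx ?orbT.
- by rewrite oq E1; case: (odd (hub q.1)); rewrite eqxx ?orbT.
- by rewrite op E1; case: (odd q.2); rewrite eqxx ?orbT.
- by rewrite op oq E1; case: (odd (hub q.1)); rewrite eqxx ?orbT.
Qed.

Definition uses (k : E * 'I_n -> 'I_n) e a b :=
  (a \in rows e) && (b == hub e) \/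
  exists x, [/\ (e, x) \in stubs, a = k (e, x) & b \in [set x; hub e]].

(** Two direct legs are separated by properness of [col], a direct leg and a connector by the choice
    of the lists, and two connectors by the list colouring. *)
Lemma uses_inj k e f a b :
  (forall p, p \in stubs -> (k p \notin cover_by rows col p.2) &&
                           (k p \notin cover_by rows col (hub p.1))) ->
  (forall p q, p \in stubs -> q \in stubs -> p != q -> k p = k q ->
    [disjoint [set p.2; hub p.1] & [set q.2; hub q.1]]) ->
  uses k e a b -> uses k f a b -> e = f.
Proof.
move=> kU kP.
have row_cover g : a \in rows g -> b = hub g -> (col g = b) /\ a \in cover_by rows col b.
  move=> ag bg; have gc : hub g = col g by apply: hub_col; apply/set0Pn; exists a.
  by rewrite bg gc; split=> //; apply/cover_byP; exists g.
have stub_cover g x : (g, x) \in stubs -> a = k (g, x) -> b \in [set x; hub g] ->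
    a \notin cover_by rows col b.
  by move=> gx -> /set2P [] ->; have /andP [] := kU _ gx.
case=> [/andP [ae /eqP be]|[x [ex aE bE]]]; case=> [/andP [af /eqP bf]|[y [fy aF bF]]].
- have [ce _] := row_cover e ae be; have [cf _] := row_cover f af bf.
  by apply: (proper_col_uniq pr _ ae af); rewrite ce cf.
- have [_ H] := row_cover e ae be.
  by have := stub_cover f y fy aF bF; rewrite H.
- have [_ H] := row_cover f af bf.
  by have := stub_cover e x ex aE bE; rewrite H.
- apply/eqP; apply: contraT => ef.
  have pq : (e, x) != (f, y) by apply: contra ef => /eqP [-> _].
  have := kP _ _ ex fy pq; rewrite -aE -aF => /(_ erefl) /pred0P /(_ b) /=.
  by rewrite bE bF.
Qed.

Lemma demand_realizable : realizable (Knn n) D.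
Proof.
have [k kU kP] := exists_connectors.
have Hpath (e : E) : exists s : seq ('I_n + 'I_n), [/\ is_gpath (Knn n) s,
    gpath_ends s = mg_ends e & forall g, g \in gpath_edges s ->
      exists a b, g = [set inl a; inr b] /\ uses k e a b].
  have leg_row a : inl a \in mg_ends e ->
      exists a0 b0, [set inl a; inr (hub e)] = [set inl a0; inr b0] /\ uses k e a0 b0.
    by move=> ae; exists a, (hub e); split=> //; left; rewrite inE ae eqxx.
  have leg_hub x : (e, x) \in stubs -> exists a0 b0,
      [set inl (k (e, x)); inr (hub e)] = [set inl a0; inr b0] /\ uses k e a0 b0.
    move=> ex; exists (k (e, x)), (hub e); split=> //; right; exists x.
    by split=> //; rewrite !inE eqxx orbT.
  have leg_col x : (e, x) \in stubs -> exists a0 b0,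
      [set inl (k (e, x)); inr x] = [set inl a0; inr b0] /\ uses k e a0 b0.
    move=> ex; exists (k (e, x)), x; split=> //; right; exists x.
    by split=> //; rewrite !inE eqxx.
  have stubP x : inr x \in mg_ends e -> x != hub e -> (e, x) \in stubs.
    by move=> xe xh; rewrite inE /= inE xe.
  have swap (u v : 'I_n) : [set inr u; inl v] = [set inl v; inr u] :> {set 'I_n + 'I_n}.
    by rewrite setUC.
  have mixed a b : mg_ends e = [set inl a; inr b] -> exists s : seq ('I_n + 'I_n),
      [/\ is_gpath (Knn n) s, gpath_ends s = mg_ends e & forall g, g \in gpath_edges s ->
      exists a b, g = [set inl a; inr b] /\ uses k e a b].
    move=> eab; have ae : inl a \in mg_ends e by rewrite eab !inE eqxx.
    have be : inr b \in mg_ends e by rewrite eab !inE eqxx orbT.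
    have [bh|bh] := eqVneq b (hub e).
      exists [:: inl a; inr b]; rewrite eab; split=> // g.
      by rewrite !inE /= bh => /eqP ->; apply: leg_row.
    have eb := stubP b be bh.
    (* The connector avoids everything covered by the colour of the hub, in particular [a], so no
       vertex repeats. *)
    have ka : k (e, b) != a.
      have /andP [_] := kU _ eb; apply: contraNneq => -> /=.
      have ar : a \in rows e by rewrite inE.
      by apply/cover_byP; exists e => //; rewrite hub_col //; apply/set0Pn; exists a.
    exists [:: inl a; inr (hub e); inl (k (e, b)); inr b]; rewrite eab; split=> //.
      rewrite /= !inE /= orbF andbT (inj_eq inl_inj) (inj_eq inr_inj).
      by rewrite eq_sym ka eq_sym.
    move=> g; rewrite !inE /= => /or3P [] /eqP ->; rewrite ?swap; first exact: leg_row.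
      exact: leg_hub.
    exact: leg_col.
  have /eqP/cards2P [u [v [uv euv]]] := mg_loopless e.
  case: u v uv euv => u [] v uv euv.
  - exists [:: inl u; inr (hub e); inl v]; rewrite euv; split=> //.
      by rewrite /= !inE /= uv.
    move=> g; rewrite !inE /= => /orP [] /eqP ->; rewrite ?swap; apply: leg_row;
      by rewrite euv !inE eqxx ?orbT.
  - exact: mixed euv.
  - by apply: (mixed v u); rewrite euv setUC.
  - have ue : inr u \in mg_ends e by rewrite euv !inE eqxx.
    have ve : inr v \in mg_ends e by rewrite euv !inE eqxx orbT.
    have direct (x y : 'I_n) : mg_ends e = [set inr x; inr y] -> x != y -> y = hub e ->
      exists s : seq ('I_n + 'I_n),
      [/\ is_gpath (Knn n) s, gpath_ends s = mg_ends e & forall g, g \in gpath_edges s ->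
      exists a b, g = [set inl a; inr b] /\ uses k e a b].
      move=> exy xy yh; have ex : (e, x) \in stubs.
        by apply: stubP; rewrite ?exy ?inE ?eqxx // -yh.
      exists [:: inr x; inl (k (e, x)); inr y]; rewrite exy; split=> //.
        by rewrite /= !inE /= xy.
      move=> g; rewrite !inE /= => /orP [] /eqP ->; rewrite ?swap; first exact: leg_col.
      by rewrite yh; apply: leg_hub.
    have [vh|vh] := eqVneq v (hub e); first exact: direct euv _ vh.
    have [uh|uh] := eqVneq u (hub e).
      by apply: (direct v u) => //; [rewrite euv setUC | rewrite eq_sym].
    have [eu ev] := (stubP u ue uh, stubP v ve vh).
    (* Both stubs contain the hub of [e], hence their connectors differ. *)
    have kuv : k (e, u) != k (e, v).
      apply/eqP => kE; have := kP _ _ eu ev _ kE; rewrite xpair_eqE eqxx.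
      by move=> /(_ uv) /pred0P /(_ (hub e)) /=; rewrite !inE eqxx !orbT.
    exists [:: inr u; inl (k (e, u)); inr (hub e); inl (k (e, v)); inr v]; rewrite euv; split=> //.
      have uv' : u != v by [].
      rewrite /= !inE /= orbF andbT !(inj_eq inl_inj) !(inj_eq inr_inj).
      by rewrite (negbTE uh) (negbTE uv') kuv eq_sym.
    move=> g; rewrite !inE /= => /or4P [] /eqP ->; rewrite ?swap.
    + exact: leg_col.
    + exact: leg_hub.
    + exact: leg_hub.
    + exact: leg_col.
have [P HP] := fin_all_exists Hpath.
exists P; split=> [e|e|e f ef]; [by case: (HP e)|by case: (HP e)|].
apply/pred0P => g /=; apply/negP => /andP [ge gf].
have [_ _ /(_ g ge) [a [b [gab uab]]]] := HP e.
have [_ _ /(_ g gf) [a' [b' [gab' uab']]]] := HP f.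
case/negP: ef; apply/eqP; apply: (uses_inj kU kP uab).
have : inl a \in [set inl a'; inr b'] by rewrite -gab' gab !inE eqxx.
have : inr b \in [set inl a'; inr b'] by rewrite -gab' gab !inE eqxx orbT.
by rewrite !inE /= orbF => /eqP [->] /eqP [->].
Qed.

End Realization.
End Demand.

Theorem realizable_of_degree n d (D : multigraph ('I_n + 'I_n)%type) :
  4 * d + 18 <= n -> (forall v, mg_degree D v <= d) -> realizable (Knn n) D.
Proof.
move=> dn deg; have [col [hub [pr U6 hc ho l6]]] := exists_hubs dn deg.
exact: (demand_realizable dn deg pr U6 hc ho l6).
Qed.

Lemma realizable_Knn0 (D : multigraph ('I_0 + 'I_0)%type) : realizable (Knn 0) D.
Proof.
have noE (e : mg_edge D) : False.
  by have /eqP/cards2P [[[]|[]]] := mg_loopless e.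
by exists (fun=> [::]); split=> e; case: (noE e).
Qed.

(* The asymptotic form of the bound *)
From mathcomp Require Import all_order all_algebra.
From mathcomp Require Import all_classical all_reals all_analysis.
From mathcomp Require Import ring lra.

Import Order.TTheory GRing.Theory Num.Theory.
Import numFieldNormedType.Exports.
Local Open Scope classical_set_scope.
Local Open Scope ring_scope.

Theorem theorem1 (R : realType) :
  exists eps : nat -> R,
    [/\ forall n : nat, 0 <= eps n,
        eps n @[n --> \oo] --> (0 : R)
      & forall (n : nat) (D : multigraph ('I_n + 'I_n)%type),
          (max_degree D)%:R <= (1 - eps n) * (n%:R / 4) ->
          realizable (Knn n) D].
Proof.
(* For positive [n] the degree bound becomes [(n - 18) / 4], that is, [4 d + 18 <= n]. *)
exists (fun n => 18 / n%:R); split.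
- by move=> n; rewrite divr_ge0.
(* The shifted sequence is 18 times the harmonic one. *)
- rewrite -(@cvg_shiftS _ (fun n => 18 / n%:R : R)).
  have := cvgM (@cvg_cst _ (18 : R) _ \oo _) (@cvg_harmonic R); rewrite mulr0.
  exact.
- case=> [|n] D degD.
    (* Here [18 / 0] is 0, so the hypothesis does not yield [4 d + 18 <= n]; but without vertices
       there are no demands. *)
    exact: realizable_Knn0.
  apply: (@realizable_of_degree _ (max_degree D)) => [|v]; last exact: leq_bigmax.
  rewrite -(ler_nat R) natrD natrM.
  have n0 : n.+1%:R != 0 :> R by rewrite pnatr_eq0.
  have E1 : (1 - 18 / n.+1%:R) * (n.+1%:R / 4) = (n.+1%:R - 18) / 4 :> R by field.
  by rewrite E1 in degD; lra.
Qed.
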